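(* The Nearest Neighbor procedure described below returns a fair periodic assignment $\mathcal{M}$ (a single directed cycle through all tasks) whose number of workers $(c(\mathcal{I})+c(\mathcal{M}))/T$ is at most $L+1$, and it can be carried out in $\mathcal{O}(n\log n)$ time. Nearest Neighbor: pick an arbitrary task $u$ and set the current task $i\leftarrow u$; mark all other tasks unvisited and set $\mathcal{M}=\emptyset$. While some task is unvisited, choose an unvisited task $v$ minimizing $c_{iv}$ (ties broken arbitrarily), add $(i,v)$ to $\mathcal{M}$, mark $v$ visited and set $i\leftarrow v$. Finally add $(i,u)$ to $\mathcal{M}$ and return $\mathcal{M}$.
   Context: Let $T$ be a positive integer (the period) and let $\mathcal{I}$ be a finite set of $n\ge 1$ tasks. For $x\in\mathbb{R}$, $[x]_T$ denotes the unique element of $[0,T)$ congruent to $x$ modulo $T$. Each task $i$ is given by $a_i,b_i\in[0,T)$ and occupies the $T$-periodic open interval $(a_i,b_i):=\{t\in[0,T):0<[t-a_i]_T<c(i)\}$, where $c(i):=[b_i-a_i]_T$ is its duration. For $t\in[0,T)$, $\mathcal{I}(t)$ is the number of tasks whose interval contains $t$, and the load is $L:=\max_{t\in[0,T)}\mathcal{I}(t)$. For every ordered pair $(i,j)$ of tasks (including $i=j$) the transition time is $c_{ij}:=[a_j-b_i]_T$. A periodic assignment is a set $\mathcal{M}\subseteq\mathcal{I}\times\mathcal{I}$ such that every task has exactly one arc of $\mathcal{M}$ leaving it and exactly one entering it; it is fair if it forms a single directed (Hamiltonian) cycle through all tasks. Write $c(\mathcal{I}):=\sum_{i}c(i)$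 and $c(\mathcal{M}):=\sum_{(i,j)\in\mathcal{M}}c_{ij}$; the number of workers required by $\mathcal{M}$ is $(c(\mathcal{I})+c(\mathcal{M}))/T$. *)

(* Defs.v *)
From HB Require Import structures.
From mathcomp Require Import all_boot all_order all_algebra.
From mathcomp Require Import all_classical all_reals all_analysis.

Set Implicit Arguments.
Unset Strict Implicit.
Unset Printing Implicit Defensive.

Import Order.TTheory GRing.Theory Num.Theory.
Import numFieldNormedType.Exports.

Local Open Scope ring_scope.

Section PeriodicTasks.
Variable R : realType.

Definition modT (T : nat) (x : R) : R :=
  x - (Num.floor (x / T%:R))%:~R * T%:R.

Record instance (I : finType) := Instance {
  period : nat;
  task_start : I -> R;
  task_stop : I -> R;
  period_gt0 : (0 < period)%N;
  tasks_gt0 : (0 < #|I|)%N;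
  task_start_itv : forall i, 0 <= task_start i < period%:R;
  task_stop_itv : forall i, 0 <= task_stop i < period%:R
}.

Variables (I : finType) (J : instance I).

Notation T := (period J).
Notation a := (task_start J).
Notation b := (task_stop J).

Definition duration (i : I) : R := modT T (b i - a i).

Definition transition (i j : I) : R := modT T (a j - b i).

Definition active (t : R) (i : I) : bool := 0 < modT T (t - a i) < duration i.

Definition active_count (t : R) : nat := #|[set i | active t i]|.

(* The set of attained values is contained in {0, ..., #|I|}, so its maximum is
   the following finite one (see [load_attained] and [load_max]). *)
Definition load : nat :=
  (\max_(k < #|I|.+1
         | `[< exists2 t : R, (0 <= t < T%:R)%R & active_count t = k >]) k)%N.

Lemma load_max t : 0 <= t < T%:R -> (active_count t <= load)%N.
Proof.
move=> tT; have kI : (active_count t < #|I|.+1)%N by rewrite ltnS max_card.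
apply: (bigop.leq_bigmax_cond (Ordinal kI)
  (F := fun k : 'I_#|I|.+1 => k : nat)).
by apply/asboolP; exists t.
Qed.

Lemma load_attained : exists2 t, 0 <= t < T%:R & active_count t = load.
Proof.
have t0 : 0 <= (0 : R) < T%:R by rewrite lexx ltr0n period_gt0.
have kI : (active_count 0 < #|I|.+1)%N by rewrite ltnS max_card.
rewrite /load.
have [|k /asboolP kP ->] := @bigop.eq_bigmax_cond 'I_#|I|.+1
  (fun k => `[< exists2 t : R, 0 <= t < T%:R & active_count t = k >])
  (fun k => k : nat).
  by apply/card_gt0P; exists (Ordinal kI); apply/asboolP; exists 0.
exact: kP.
Qed.

Definition periodic_assignment (M : {set I * I}) : Prop :=
  (forall i, #|[set p in M | p.1 == i]| = 1%N) /\
  (forall j, #|[set p in M | p.2 == j]| = 1%N).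

(* [next s i] is the cyclic successor of [i] in [s]. *)
Definition hamiltonian_cycle (M : {set I * I}) : Prop :=
  exists s : seq I,
    [/\ uniq s, forall i, i \in s & M = [set (i, next s i) | i : I]].

Definition fair_assignment (M : {set I * I}) : Prop :=
  periodic_assignment M /\ hamiltonian_cycle M.

Definition workers (M : {set I * I}) : R :=
  (\sum_i duration i + \sum_(p in M) transition p.1 p.2) / T%:R.

(* [nn_loop u i U M M']: with first task [u], current task [i], unvisited tasks
   [U] and arcs [M] selected so far, the procedure may return [M']. *)
Inductive nn_loop (u : I) : I -> {set I} -> {set I * I} -> {set I * I} -> Prop :=
| NNDone i M : nn_loop u i finset.set0 M ((i, u) |: M)
| NNStep i v (U : {set I}) M M' :
    v \in U ->
    (forall w, w \in U -> transition i v <= transition i w) ->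
    nn_loop u v (U :\ v) ((i, v) |: M) M' ->
    nn_loop u i U M M'.

Definition nearest_neighbor (u : I) (M : {set I * I}) : Prop :=
  nn_loop u u [set~ u] finset.set0 M.

End PeriodicTasks.

(* A unit-cost real RAM, presented as a structured language.  There are two
   kinds of cells, holding natural numbers and real numbers, organised in arrays;
   the array names occurring in a program are constants, the indices within an
   array are computed.  Reals can only be added, subtracted and compared: there
   is no rounding, and no conversion between the two kinds. *)
Inductive nexp :=
| NConst of nat
| NRead of nat & nexp
| NAdd of nexp & nexp
| NSub of nexp & nexp
| NHalf of nexp.

Inductive rexp :=
| RRead of nat & nexp
| RAdd of rexp & rexp
| RSub of rexp & rexp.

Inductive bexp :=
| BLeN of nexp & nexp
| BLeR of rexp & rexp
| BNot of bexp
| BAnd of bexp & bexp.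

Inductive cmd :=
| Skip
| NWrite of nat & nexp & nexp
| RWrite of nat & nexp & rexp
| Seq of cmd & cmd
| If of bexp & cmd & cmd
| While of bexp & cmd.

Fixpoint ncost (e : nexp) : nat :=
  match e with
  | NConst _ => 1
  | NRead _ e1 | NHalf e1 => (ncost e1).+1
  | NAdd e1 e2 | NSub e1 e2 => (ncost e1 + ncost e2).+1
  end.

Fixpoint rcost (e : rexp) : nat :=
  match e with
  | RRead _ e1 => (ncost e1).+1
  | RAdd e1 e2 | RSub e1 e2 => (rcost e1 + rcost e2).+1
  end.

Fixpoint bcost (e : bexp) : nat :=
  match e with
  | BLeN e1 e2 => (ncost e1 + ncost e2).+1
  | BLeR e1 e2 => (rcost e1 + rcost e2).+1
  | BNot e1 => (bcost e1).+1
  | BAnd e1 e2 => (bcost e1 + bcost e2).+1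
  end.

Section Machine.
Variable R : realType.

Record memory := Memory {
  nmem : nat -> nat -> nat;
  rmem : nat -> nat -> R
}.

Definition update (V : Type) (f : nat -> nat -> V) (x k : nat) (v : V) :
    nat -> nat -> V :=
  fun x' k' => if (x' == x) && (k' == k) then v else f x' k'.

Fixpoint neval (s : memory) (e : nexp) : nat :=
  match e with
  | NConst k => k
  | NRead x e1 => nmem s x (neval s e1)
  | NAdd e1 e2 => neval s e1 + neval s e2
  | NSub e1 e2 => neval s e1 - neval s e2
  | NHalf e1 => (neval s e1)./2
  end%N.

Fixpoint reval (s : memory) (e : rexp) : R :=
  match e with
  | RRead x e1 => rmem s x (neval s e1)
  | RAdd e1 e2 => reval s e1 + reval s e2
  | RSub e1 e2 => reval s e1 - reval s e2
  end.

Fixpoint beval (s : memory) (e : bexp) : bool :=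
  match e with
  | BLeN e1 e2 => (neval s e1 <= neval s e2)%N
  | BLeR e1 e2 => reval s e1 <= reval s e2
  | BNot e1 => ~~ beval s e1
  | BAnd e1 e2 => beval s e1 && beval s e2
  end.

(* [exec P s t s']: started in [s], [P] halts in [s'] after exactly [t] steps. *)
Inductive exec : cmd -> memory -> nat -> memory -> Prop :=
| ESkip s : exec Skip s 1 s
| ENWrite x e1 e2 s :
    exec (NWrite x e1 e2) s (ncost e1 + ncost e2).+1
      (Memory (update (nmem s) x (neval s e1) (neval s e2)) (rmem s))
| ERWrite x e1 e2 s :
    exec (RWrite x e1 e2) s (ncost e1 + rcost e2).+1
      (Memory (nmem s) (update (rmem s) x (neval s e1) (reval s e2)))
| ESeq P Q s t s' t' s'' :
    exec P s t s' -> exec Q s' t' s'' -> exec (Seq P Q) s (t + t') s''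
| EIfTrue e P Q s t s' :
    beval s e -> exec P s t s' -> exec (If e P Q) s (bcost e + t).+1 s'
| EIfFalse e P Q s t s' :
    ~~ beval s e -> exec Q s t s' -> exec (If e P Q) s (bcost e + t).+1 s'
| EWhileFalse e P s :
    ~~ beval s e -> exec (While e P) s (bcost e).+1 s
| EWhileTrue e P s t s' t' s'' :
    beval s e -> exec P s t s' -> exec (While e P) s' t' s'' ->
    exec (While e P) s (bcost e + t + t').+1 s''.

(* Input: natural array 0 holds [n; u], real array 0 holds [T], and real arrays
   1 and 2 hold the [a_i] and the [b_i]; every other cell is 0. *)
Definition input (n : nat) (J : instance R 'I_n) (u : 'I_n) : memory :=
  {| nmem x k := if x == 0 then nth 0 [:: n; val u] k else 0;
     rmem x k :=
       match x with
       | 0 => nth 0%R [:: (period J)%:R] k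
       | 1 => nth 0%R [seq task_start J i | i <- enum 'I_n] k
       | 2 => nth 0%R [seq task_stop J i | i <- enum 'I_n] k
       | _ => 0%R
       end |}%N.

(* Output: natural array 1 holds, at index [i], the head of the arc leaving [i]. *)
Definition output (n : nat) (s : memory) : {set 'I_n * 'I_n} :=
  [set p | nmem s 1 (val p.1) == val p.2].

(* [P] carries out the nearest neighbor procedure from every first task [u] on
   every instance with [n] tasks, within [tm n] steps. *)
Definition implements_nn (P : cmd) (tm : nat -> nat) : Prop :=
  forall (n : nat) (J : instance R 'I_n) (u : 'I_n),
  exists t s', [/\ exec P (input J u) t s', (t <= tm n)%N
                 & nearest_neighbor J u (output n s')].

End Machine.

(* Main.v *)
(* Workers: for every point x, the number of workers equals the number of
   half-open intervals [a_i, b_i) and [b_i, a_j), (i, j) in M, that contain x,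
   because T times the indicator of [p, q) at x is
   [x - q]_T - [x - p]_T + [q - p]_T and the first two terms telescope around
   the cycle.  Take x = a_w, where w is the task visited last.  Whenever another
   arc (i, v) was chosen, w was available, so c_iv <= c_iw and [b_i, a_v) misses
   a_w; only the closing arc can contain a_w.  A point slightly to the right of
   a_w lies in all open task intervals whose half-open version contains a_w,
   hence there are at most L of these.

   Running time: a tournament tree, whose inner nodes hold the task of largest
   start time below them, supports updates and the query "rightmost leaf with
   start time at least x" in logarithmic time.  Emptying a first tree sorts the
   tasks by decreasing start time.  In a second tree, with leaves in that order,
   the rightmost leaf with start time at least b_i is the nearest neighbor of i;
   when there is none, it is the unvisited task starting first, i.e. the
   rightmost leaf with start time at least 0. *)
Require Import Defs.
From HB Require Import structures.
From mathcomp Require Import all_boot all_order all_algebra.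
From mathcomp Require Import all_classical all_reals all_analysis.
From mathcomp Require Import lra zify.

Set Implicit Arguments.
Unset Strict Implicit.
Unset Printing Implicit Defensive.

Import Order.TTheory GRing.Theory Num.Theory.
Import numFieldNormedType.Exports.

Local Open Scope classical_set_scope.
Local Open Scope ring_scope.

(** * The number of workers *)

Section ModT.
Variables (R : realType) (T : nat).
Hypothesis T_gt0 : (0 < T)%N.
Implicit Types x y p q : R.

Lemma modT_itv x : 0 <= modT T x < T%:R.
Proof.
have T0 : 0 < T%:R :> R by rewrite ltr0n.
rewrite /modT subr_ge0 -ler_pdivlMr // floor_le /=.
rewrite ltrBlDl -[X in _ + X]mul1r -mulrDl -ltr_pdivrMr //.
by rewrite -[1]/(1%:~R) -intrD floorD1_gt.
Qed.

Lemma modT_uniq x y (k : int) :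
  0 <= y < T%:R -> x = y + k%:~R * T%:R -> modT T x = y.
Proof.
move=> /andP[y0 yT] ->; have T0 : 0 < T%:R :> R by rewrite ltr0n.
rewrite /modT mulrDl mulfK ?gt_eqF // floorDrz ?intr_int //.
rewrite intrKfloor intrD mulrDl.
have -> : Num.floor (y / T%:R) = 0.
  by apply: floor_def; rewrite add0r divr_ge0 ?(ltW T0) //= ltr_pdivrMr ?mul1r.
by rewrite mul0r add0r addrK.
Qed.

Lemma modT_id x : 0 <= x < T%:R -> modT T x = x.
Proof.
by move=> xT; apply: (modT_uniq (k := 0)) => //; rewrite mul0r addr0.
Qed.

Lemma modT_decomp x : exists k : int, x = modT T x + k%:~R * T%:R.
Proof. by exists (Num.floor (x / T%:R)); rewrite subrK. Qed.

(** With [y] and [z] the residues of [x - p] and [q - p], the difference [y - z] is congruent to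
    [x - q] and lies strictly between [- T] and [T]. So the residue of [x - q] is [y - z + T] if
    [y < z], and [y - z] otherwise. *)
Lemma modT_covers p q x :
  (modT T (x - p) < modT T (q - p))%R%:R * T%:R
  = modT T (x - q) - modT T (x - p) + modT T (q - p).
Proof.
have := modT_itv (x - p); have := modT_itv (q - p).
have [k xp] := modT_decomp (x - p); have [l qp] := modT_decomp (q - p).
set y := modT T (x - p) in xp *; set z := modT T (q - p) in qp *.
move=> /andP[z0 zT] /andP[y0 yT].
have xq : x - q = y - z + (k - l)%:~R * T%:R.
  rewrite intrB mulrBl; move: xp qp; move: (_ * _) (l%:~R * _) => ? ? ? ?.
  lra.
have [yz|zy] := ltrP y z.
  rewrite (@modT_uniq (x - q) (y - z + T%:R) (k - l - 1)) ?mul1r; first lra.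
    by apply/andP; split; lra.
  by rewrite xq [in RHS]intrB mulrBl mul1r; lra.
rewrite (modT_uniq _ xq) ?mul0r; first lra.
by apply/andP; split; lra.
Qed.

End ModT.

(** * Counting the workers at a point *)

Section Workers.
Variables (R : realType) (I : finType) (J : instance R I).
Notation T := (period J).
Notation a := (task_start J).
Notation b := (task_stop J).

(** A small enough shift of [x] to the right lands strictly inside all the counted task intervals at
    once. *)
Lemma half_open_le_load x :
  (#|[set i | (modT T (x - a i) < duration J i)%R]%SET| <= load J)%N.
Proof.
have T0 := period_gt0 J.
set S := [set i | _]%SET.
(* The least distance from [x] to the right end of a counted interval, capped by 1 so that an empty
   [S] is covered; shifting by half of it stays strictly inside. *)
pose e := \big[Num.min/1]_(i in S) (duration J i - modT T (x - a i)).
have e0 : 0 < e.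
  rewrite /e; elim/big_ind: _ => // [y z|i].
    by rewrite lt_min => -> ->.
  by rewrite inE subr_gt0.
have ei i : i \in S -> e / 2 < duration J i - modT T (x - a i).
  move=> iS; apply: (@lt_le_trans _ _ e); first lra.
  by rewrite /e (bigD1 i) //= ge_min lexx.
have t_itv := modT_itv T0 (x + e / 2).
apply: leq_trans (load_max t_itv); apply: subset_leq_card.
apply/fintype.subsetP => i iS; rewrite inE /active.
have [k xk] := modT_decomp T (x + e / 2).
have [l xl] := modT_decomp T (x - a i).
have /andP[p0 pT] := modT_itv T0 (x - a i).
have /andP[_ dT] := modT_itv T0 (b i - a i).
have := ei i iS; rewrite /duration => ei_i.
(* Relative to [a i] the shift causes no wrap-around: the residue just grows by [e / 2]. *)
rewrite (@modT_uniq _ _ T0 _ (modT T (x - a i) + e / 2) (l - k)).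
- by apply/andP; split; lra.
- by apply/andP; split; lra.
- move: xk xl; rewrite intrB mulrBl; move: (_ * _) (l%:~R * _) => ? ? ? ?; lra.
Qed.

Variable s : seq I.
Hypotheses (s_uniq : uniq s) (s_all : forall i, i \in s).

Let M := [set (i, next s i) | i : I]%SET.

Lemma next_inj : injective (next s).
Proof. exact: can_inj (prev_next s_uniq). Qed.

Lemma mem_cycle_arcs p : (p \in M) = (p.2 == next s p.1).
Proof.
apply/imsetP/eqP => [[i _ ->] //|]; case: p => i j /= ->.
by exists i.
Qed.

Lemma cycle_fair : fair_assignment M.
Proof.
split; last by exists s.
split=> i.
  rewrite -(cards1 (i, next s i)); apply: eq_card => -[x y].
  rewrite !inE mem_cycle_arcs /= xpair_eqE andbC.
  by case: eqP => // ->.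
rewrite -(cards1 (prev s i, i)); apply: eq_card => -[x y].
rewrite !inE mem_cycle_arcs /= xpair_eqE andbC [RHS]andbC.
case: (y =P i) => // ->; apply/eqP/eqP => ->.
  by rewrite prev_next.
by rewrite next_prev.
Qed.

Lemma sum_cycle_arcs (F : I * I -> R) :
  \sum_(p in M) F p = \sum_i F (i, next s i).
Proof. by rewrite big_imset //= => i j _ _ []. Qed.

(** Summing [modT_covers], the residues of [x - b i] cancel between each task and its outgoing arc,
    those of [x - a i] between each task and its incoming arc. *)
Lemma workers_covers x :
  workers J M = #|[set i | modT T (x - a i) < duration J i]%SET|%:R
    + #|[set p in M | modT T (x - b p.1) < transition J p.1 p.2]%SET|%:R.
Proof.
have T0 := period_gt0 J; have TR : T%:R != 0 :> R by rewrite pnatr_eq0 -lt0n.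
apply: (mulIf TR); rewrite /workers divfK // mulrDl.
have countE (K : finType) (P : pred K) :
    #|[set k | P k]%SET|%:R * T%:R = \sum_k ((P k)%:R * T%:R : R).
  rewrite -mulr_suml -natr_sum; congr (_%:R * _).
  by rewrite -big_mkcond /= sum1dep_card.
rewrite !countE (eq_bigr _ (fun i _ => modT_covers T0 (a i) (b i) x)).
have -> : \sum_p ((p \in M) && (modT T (x - b p.1) < transition J p.1 p.2))%R%:R
            * T%:R
  = \sum_(p in M) (modT T (x - a p.2) - modT T (x - b p.1)
      + transition J p.1 p.2) :> R.
  rewrite [RHS]big_mkcond /=; apply: eq_bigr => p _.
  case: ifP => _ /=; last by rewrite mul0r.
  exact: modT_covers.
have split3 (K : finType) (P : pred K) (F G H : K -> R) :
    \sum_(k | P k) (F k - G k + H k)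
    = \sum_(k | P k) F k - \sum_(k | P k) G k + \sum_(k | P k) H k.
  by rewrite big_split sumrB.
rewrite (split3 _ _ (fun i => modT T (x - b i))).
rewrite (split3 _ _ (fun p => modT T (x - a p.2))) /=.
rewrite (sum_cycle_arcs (fun p => modT T (x - a p.2))) /=.
rewrite (sum_cycle_arcs (fun p => modT T (x - b p.1))) /=.
(* Each task is the head of exactly one arc, so [next s] merely permutes the sum. *)
have <- : \sum_i modT T (x - a i) = \sum_i modT T (x - a (next s i)).
  by rewrite [LHS](reindex_inj next_inj).
rewrite -[\sum_k modT T (b k - a k)]/(\sum_i duration J i); lra.
Qed.

End Workers.

(** * Outcomes of the nearest neighbor procedure *)

Section NearestNeighbor.
Variables (R : realType) (I : finType) (J : instance R I).

Lemma nn_loop_exists u i U M : exists M', nn_loop J u i U M M'.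
Proof.
move: i M; have [k] := ubnP #|U|; elim: k U => // k IH U Uk i M.
have [->|[v0 v0U]] := set_0Vmem U; first by eexists; apply: NNDone.
case: (arg_minP (fun v => transition J i v) v0U) => v vmem vmin.
have vU : v \in U := vmem.
have [|M' M'P] := IH (U :\ v)%SET _ v ((i, v) |: M)%SET.
  by move: Uk; rewrite (cardsD1 v U) vU.
by exists M'; apply: (NNStep (v := v)).
Qed.

(** Here [s] is the visiting order after [i]. Its last task is available at every choice, so the
    minimality of each chosen arc can be tested against it; only the closing arc escapes this
    comparison. *)
Lemma nn_loop_seq u i U M M' : nn_loop J u i U M M' -> exists s : seq I,
  [/\ uniq s, s =i U, M' = (M :|: [set p in zip (i :: s) (rcons s u)])%SET
    & {in zip (i :: s) (rcons s u), forall p, p = (last i s, u) \/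
        transition J p.1 p.2 <= transition J p.1 (last i s)}].
Proof.
elim=> {i U M M'} [i M|i v U M M' vU vmin _ [s [us sU -> smin]]].
  exists [::]; split=> //; first by move=> x; rewrite !inE.
    by apply/setP => p; rewrite !inE orbC.
  by move=> p /=; rewrite inE => /eqP ->; left.
have vs : v :: s =i U.
  move=> x; rewrite inE sU !inE; case: eqP => //= ->; by rewrite vU.
exists (v :: s); split=> //=.
- by rewrite us sU !inE eqxx.
- apply/setP => p; rewrite !inE.
  by case: (p == (i, v)); rewrite //= ?orbT.
- move=> p; rewrite inE => /orP[/eqP ->|]; last exact: smin.
  by right; apply: vmin; rewrite -vs mem_last.
Qed.

Lemma zip_next (u : I) (s : seq I) : uniq (u :: s) ->
  (forall i, i \in u :: s) ->
  [set p in zip (u :: s) (rcons s u)]%SET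
  = [set (i, next (u :: s) i) | i : I]%SET.
Proof.
move=> us sall; apply/setP => -[x y]; rewrite inE.
have szE : size (zip (u :: s) (rcons s u)) = (size s).+1.
  by rewrite size_zip size_rcons minnn.
(* Reading [s] past its end returns the default [u], the very element that [rcons] appends. *)
have nthE k : nth u (rcons s u) k = nth u s k.
  rewrite nth_rcons; case: ltngtP => [//|sk|->]; rewrite nth_default //.
  exact: ltnW.
apply/idP/imsetP => [/(nthP (u, u))[k]|[i _ [-> ->]]].
  rewrite szE => ks; rewrite nth_zip ?size_rcons // nthE => -[<- <-].
  exists (nth u (u :: s) k) => //.
  by rewrite next_nth sall index_uniq.
apply/(nthP (u, u)); exists (index i (u :: s)).
  by rewrite szE -[X in (_ < X)%N]/(size (u :: s)) index_mem.
rewrite nth_zip ?size_rcons // nthE nth_index //.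
by rewrite -[next_at i u u s]/(next (u :: s) i) next_nth sall.
Qed.

Lemma nearest_neighbor_fair_workers u M : nearest_neighbor J u M ->
  fair_assignment M /\ workers J M <= (load J + 1)%:R.
Proof.
move=> /nn_loop_seq[s [us sU ME smin]].
have usu : uniq (u :: s) by rewrite /= us sU !inE eqxx.
have sall i : i \in u :: s by rewrite inE sU !inE orbN.
have MN : M = [set (i, next (u :: s) i) | i : I]%SET.
  by rewrite ME finset.set0U zip_next.
split; first by rewrite MN; apply: cycle_fair.
pose w := last u s.
rewrite MN (workers_covers J usu (task_start J w)) -MN natrD lerD //.
  by rewrite ler_nat half_open_le_load.
(* The residue of [a w - b i] is the transition time from [i] to [w], so an arc leaving [i] that is
   no longer than this does not cover [a w]. *)
rewrite ler_nat -(cards1 (w, u)); apply: subset_leq_card.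
apply/fintype.subsetP => p; rewrite inE ME finset.set0U !inE.
move=> /andP[/smin[->//|]].
by rewrite leNgt => /negP.
Qed.

End NearestNeighbor.

(** * Timed weakest preconditions *)

Section WeakestPrecondition.
Variable R : realType.
Implicit Types (s : memory R) (Q : memory R -> Prop).

(** Total correctness: a halting run is asserted. The bound [t] need not be sharp, which lets
    branches of different cost share one bound. *)
Definition wp (c : cmd) (t : nat) Q s : Prop :=
  exists t' s', [/\ exec c s t' s', (t' <= t)%N & Q s'].

Lemma wp_mono c t t' Q Q' s :
  wp c t Q s -> (t <= t')%N -> (forall s', Q s' -> Q' s') -> wp c t' Q' s.
Proof.
move=> [t0 [s' [cs tt Qs]]] le_t QQ'.
by exists t0, s'; split=> //; [apply: leq_trans le_t | apply: QQ'].
Qed.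

Lemma wp_le c t t' Q s : wp c t Q s -> (t <= t')%N -> wp c t' Q s.
Proof. by move=> H le_t; apply: wp_mono H le_t _. Qed.

Lemma wp_nwrite x e1 e2 Q s :
  Q (Memory (update (nmem s) x (neval s e1) (neval s e2)) (rmem s)) ->
  wp (NWrite x e1 e2) (ncost e1 + ncost e2).+1 Q s.
Proof. by move=> Qs; do 2!eexists; split; [exact: ENWrite| |exact: Qs]. Qed.

Lemma wp_rwrite x e1 e2 Q s :
  Q (Memory (nmem s) (update (rmem s) x (neval s e1) (reval s e2))) ->
  wp (RWrite x e1 e2) (ncost e1 + rcost e2).+1 Q s.
Proof. by move=> Qs; do 2!eexists; split; [exact: ERWrite| |exact: Qs]. Qed.

Lemma wp_seq c d t t' Q s :
  wp c t (fun s' => wp d t' Q s') s -> wp (Seq c d) (t + t') Q s.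
Proof.
move=> [t0 [s1 [cs t0t [t1 [s2 [ds t1t Qs]]]]]].
by exists (t0 + t1)%N, s2; split; [exact: ESeq cs ds|exact: leq_add|].
Qed.

Lemma wp_if e c d t t' Q s :
  (beval s e -> wp c t Q s) -> (~~ beval s e -> wp d t' Q s) ->
  wp (If e c d) (bcost e + maxn t t').+1 Q s.
Proof.
move=> ct df; case: (boolP (beval s e)) => es.
  have [t0 [s' [cs t0t Qs]]] := ct es.
  exists (bcost e + t0).+1, s'; split=> //; first exact: EIfTrue.
  by rewrite ltnS leq_add2l (leq_trans t0t) // leq_maxl.
have [t0 [s' [ds t0t Qs]]] := df es.
exists (bcost e + t0).+1, s'; split=> //; first exact: EIfFalse.
by rewrite ltnS leq_add2l (leq_trans t0t) // leq_maxr.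
Qed.

(** The index [r] of the invariant bounds the number of remaining iterations. It may drop by more
    than one, hence the strong induction. *)
Lemma wp_while e c t (Inv : nat -> memory R -> Prop) Q :
  (forall r s, Inv r s -> beval s e ->
     exists2 r', (r' < r)%N & wp c t (Inv r') s) ->
  (forall r s, Inv r s -> ~~ beval s e -> Q s) ->
  forall r s, Inv r s ->
    wp (While e c) (r * (bcost e + t).+1 + (bcost e).+1)%N Q s.
Proof.
move=> step stop r; elim/ltn_ind: r => r IH s Is.
case: (boolP (beval s e)) => es; last first.
  exists (bcost e).+1, s; split; first exact: EWhileFalse.
    exact: leq_addl.
  exact: stop Is es.
have [r' r'r [t0 [s1 [cs t0t Is1]]]] := step _ _ Is es.
have [t1 [s2 [ws t1t Qs]]] := IH _ r'r _ Is1.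
exists (bcost e + t0 + t1).+1, s2; split=> //; first exact: EWhileTrue cs ws.
have : (r'.+1 * (bcost e + t).+1 <= r * (bcost e + t).+1)%N.
  by rewrite leq_mul2r r'r orbT.
by rewrite mulSn; lia.
Qed.

(** This covers the natural arrays only; real arrays are tracked by separate equations. *)
Definition frame (A : seq nat) s s' : Prop :=
  forall x k, x \notin A -> nmem s' x k = nmem s x k.

Lemma frame_trans A s1 s2 s3 : frame A s1 s2 -> frame A s2 s3 -> frame A s1 s3.
Proof. by move=> f12 f23 x k xA; rewrite f23 // f12. Qed.

Lemma frame_sub A B s s' : {subset A <= B} -> frame A s s' -> frame B s s'.
Proof. by move=> AB f x k xB; apply: f; apply: contra xB; apply: AB. Qed.

Lemma frame_update A s x k v r :
  x \in A -> frame A s (Memory (update (nmem s) x k v) r).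
Proof.
move=> xA y l yA /=; rewrite /update; case: eqP => // yx.
by rewrite yx xA in yA.
Qed.

End WeakestPrecondition.

(** * Tournament trees *)

Section Tournament.
Variables (R : realType) (key : nat -> R).
Implicit Types f : nat -> nat.

Definition max_node f k : Prop :=
  key (f k) = Num.max (key (f (k + k)%N)) (key (f (k + k + 1)%N)).

(* Heap numbering: the root is cell 1, the children of cell [k] are [2k] and
   [2k+1], and the leaves are the cells [m], ..., [2m-1]. *)
Definition tournament (m : nat) f (leaf : nat -> nat) : Prop :=
  (forall k, (0 < k < m)%N -> max_node f k) /\
  (forall j, (j < m)%N -> f (m + j)%N = leaf j).

Lemma tournament_ext m f l l' : tournament m f l ->
  (forall j, (j < m)%N -> l j = l' j) -> tournament m f l'.
Proof. by case=> fm fl ll'; split=> // j jm; rewrite fl // ll'. Qed.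

(** In heap numbering the interval holds the descendants of [k] lying [r] levels below it. The
    induction passes to the child whose half of the interval contains [j]. *)
Lemma subtree_le m f r k j :
  (forall k, (0 < k < m)%N -> max_node f k) ->
  (0 < k)%N -> (k * 2 ^ r <= j < k.+1 * 2 ^ r)%N -> (j < m + m)%N ->
  key (f j) <= key (f k).
Proof.
move=> fm; elim: r k => [|r IH] k k0.
  rewrite !expn0 !muln1 ltnS => kj _.
  by have -> : j = k by apply/eqP; rewrite eqn_leq andbC.
rewrite expnS => kj jm; have r0 : (0 < 2 ^ r)%N by rewrite expn_gt0.
(* A proper ancestor of a cell below [2m] is an inner node. *)
have km : (0 < k < m)%N by nia.
rewrite (fm k) // le_max; have [jk|kj'] := ltnP j ((k + k + 1) * 2 ^ r).
  by rewrite IH //; nia.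
by rewrite [X in _ || X]IH ?orbT //; nia.
Qed.

Lemma leaf_le_root h f l j : tournament (2 ^ h) f l -> (j < 2 ^ h)%N ->
  key (l j) <= key (f 1%N).
Proof.
move=> [fm fl] jm; rewrite -fl //; apply: (@subtree_le (2 ^ h) f h) => //; lia.
Qed.

End Tournament.

(** * Programs operating on a tournament tree *)

Definition var x := NRead x (NConst 0).
Definition assign x e := NWrite x (NConst 0) e.

(* Array numbers.  Arrays 4 to 9 are used as scalars, through their cell 0. *)
Local Notation nodes := 2%N.
Local Notation order := 3%N.
Local Notation width := 4%N.
Local Notation cur := 5%N.
Local Notation idx := 6%N.
Local Notation won := 7%N.
Local Notation task := 8%N.
Local Notation count := 9%N.
Local Notation keys := 3%N.
Local Notation thr := 4%N.

Definition left_child := NAdd (var cur) (var cur).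
Definition right_child := NAdd left_child (NConst 1).
Definition key_at e := RRead keys (NRead nodes e).

Definition repair :=
  While (BLeN (NConst 2) (var cur))
    (Seq (assign cur (NHalf (var cur)))
      (If (BLeR (key_at left_child) (key_at right_child))
        (NWrite nodes (var cur) (NRead nodes right_child))
        (NWrite nodes (var cur) (NRead nodes left_child)))).

Definition set_leaf e := Seq (NWrite nodes (var cur) e) repair.

(** Going right whenever the winner there reaches the threshold leads to the rightmost leaf that
    does. *)
Definition descend :=
  Seq (assign cur (NConst 1))
    (While (BLeN (NAdd (var cur) (NConst 1)) (var width))
      (If (BLeR (RRead thr (NConst 0)) (key_at right_child))
        (assign cur right_child)
        (assign cur left_child))).

Definition pop :=
  Seq descend (Seq (assign won (NRead nodes (var cur))) (set_leaf (NConst 0))).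

Definition for_count c :=
  Seq (assign idx (NConst 0))
    (While (BLeN (NAdd (var idx) (NConst 1)) (var count))
      (Seq c (assign idx (NAdd (var idx) (NConst 1))))).

(** * Correctness and cost of the tree operations *)

Section TreePrograms.
Variable R : realType.
Implicit Types (s : memory R) (Q : memory R -> Prop).

Lemma wp_for_count N c t (Inv : nat -> memory R -> Prop) s :
  nmem s count 0 = N ->
  Inv 0%N (Memory (update (nmem s) idx 0 0) (rmem s)) ->
  (forall j s, (j < N)%N -> nmem s idx 0 = j -> nmem s count 0 = N -> Inv j s ->
     wp c t (fun s' => [/\ nmem s' idx 0 = j, nmem s' count 0 = N
       & Inv j.+1 (Memory (update (nmem s') idx 0 j.+1) (rmem s'))]) s) ->
  wp (for_count c) (N * (t + 20) + 20)%N (Inv N) s.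
Proof.
move=> sN I0 step; eapply wp_le.
  apply: wp_seq; apply: wp_nwrite => /=.
  pose K r s := exists j, [/\ (j + r = N)%N, nmem s idx 0 = j,
    nmem s count 0 = N & Inv j s].
  apply: (@wp_while _ _ _ _ K _ _ _ N).
  - move=> r s1 [j [jr s1j s1N Ij]] /=; rewrite s1j s1N => jN.
    exists r.-1; first lia.
    apply: wp_seq.
    apply: wp_mono (step j s1 _ s1j s1N Ij) (leqnn _) _; first lia.
    move=> s2 [s2j s2N I2]; apply: wp_nwrite => /=.
    by exists j.+1; rewrite s2j addn1; split=> //; lia.
  - move=> r s1 [j [jr s1j s1N Ij]] /=; rewrite s1j s1N => jN.
    by have <- : j = N by lia.
  - by exists 0%N.
by rewrite /=; nia.
Qed.

(* The invariant of the loop: only proper ancestors of the current cell, the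
   iterated halves of its index, may violate [max_node]. *)
Lemma wp_repair key m e k0 s :
  rmem s keys = key -> nmem s cur 0 = k0 ->
  (0 < k0 < 2 ^ e)%N -> (k0 < m + m)%N ->
  (forall k, (0 < k < m)%N -> (forall i, k != iter i.+1 half k0) ->
     max_node key (nmem s nodes) k) ->
  wp repair (e * 60 + 10)%N
    (fun s' => [/\ forall k, (0 < k < m)%N -> max_node key (nmem s' nodes) k,
        forall j, (m <= j)%N -> nmem s' nodes j = nmem s nodes j,
        frame [:: nodes; cur] s s' & rmem s' = rmem s]) s.
Proof.
move=> skey sk k0e k0m good0.
(* Since [k < 2 ^ r], the index [r] bounds the number of halvings left. *)
pose K r s' := exists k, [/\ nmem s' cur 0 = k,
  (0 < k < 2 ^ r)%N && (k < m + m)%N,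
  forall k', (0 < k' < m)%N -> (forall i, k' != iter i.+1 half k) ->
     max_node key (nmem s' nodes) k',
  forall j, (m <= j)%N -> nmem s' nodes j = nmem s nodes j &
  frame [:: nodes; cur] s s' /\ rmem s' = rmem s].
eapply wp_le.
  apply: (@wp_while _ _ _ _ K _ _ _ e).
  - move=> r s1 [k [s1k /andP[kr km] good leaves [fr rm]]] /=.
    rewrite s1k => k2.
    exists r.-1; first by case: r kr => [|r] //; rewrite expn0; lia.
    have r1 : (0 < r)%N by case: r kr => //; rewrite expn0; lia.
    have kr' : (k./2 < 2 ^ r.-1)%N.
      by move: kr; rewrite -[in X in X -> _](prednK r1) expnS; lia.
    (* Shared by both branches: storing the winner of the two children at the parent restores the
       invariant one level up. *)
    have upd v : key v = Num.max (key (nmem s1 nodes (k./2 + k./2)%N))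
           (key (nmem s1 nodes (k./2 + k./2 + 1)%N)) ->
        K r.-1 (Memory (update (update (nmem s1) cur 0 k./2) nodes k./2 v)
          (rmem s1)).
      move=> keyv; exists k./2; split=> //=.
      - by apply/andP; split; lia.
      - move=> k' k'm anc; rewrite /max_node /update /=.
        (* If the rewritten cell were a child of [k'], then [k'] would be one of the exempted
           ancestors. *)
        have -> : (k' + k' == k./2)%N = false.
          by apply/eqP => kk; move/eqP: (anc 0%N); apply; rewrite /=; lia.
        have -> : (k' + k' + 1 == k./2)%N = false.
          by apply/eqP => kk; move/eqP: (anc 0%N); apply; rewrite /=; lia.
        case: eqP => [->|k'k] //; apply: good => // -[|i]; first exact/eqP.
        by have := anc i; rewrite -iterSr.
      - move=> j mj; rewrite /update /=; case: eqP => [jk|_]; first lia.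
        exact: leaves.
      - split=> //; apply: frame_trans fr _.
        apply: (@frame_trans _ _ _
          (Memory (update (nmem s1) cur 0 k./2) (rmem s1))).
          exact: frame_update.
        exact: frame_update.
    apply: wp_seq; apply: wp_nwrite.
    apply: wp_if => /=; rewrite !s1k rm skey /=.
      move=> le; apply: wp_nwrite => /=; rewrite -rm.
      by apply: upd; rewrite max_r.
    rewrite -ltNge => lt; apply: wp_nwrite => /=; rewrite -rm.
    by apply: upd; rewrite max_l // ltW.
  - move=> r s1 [k [s1k /andP[kr km] good leaves [fr rm]]] /=.
    rewrite s1k => k2.
    (* At the root every further half is 0, so no inner node remains exempted. *)
    split=> // k' k'm; apply: good => // i; have -> : k = 1%N by lia.
    by rewrite iterSr /= iter_fix //; lia.
  - by exists k0; split=> //; apply/andP.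
by rewrite /=; nia.
Qed.

Lemma wp_set_leaf key h e j l s :
  rmem s keys = key -> nmem s cur 0 = (2 ^ h + j)%N -> (j < 2 ^ h)%N ->
  tournament key (2 ^ h) (nmem s nodes) l ->
  wp (set_leaf e) (ncost e + h * 60 + 80)%N
    (fun s' => [/\ tournament key (2 ^ h) (nmem s' nodes)
           (fun i => if i == j then neval s e else l i),
        frame [:: nodes; cur] s s' & rmem s' = rmem s]) s.
Proof.
move=> skey sk jh [good leaves]; eapply wp_le.
  apply: wp_seq; apply: wp_nwrite.
  apply: wp_mono (@wp_repair key (2 ^ h) h.+1 (2 ^ h + j) _ _ _ _ _ _)
    (leqnn _) _ => //=.
  - by rewrite expnS; lia.
  - lia.
  - move=> k km anc; rewrite /max_node /update /= sk.
    have -> : (k + k == 2 ^ h + j)%N = false.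
      by apply/eqP => kk; move/eqP: (anc 0%N); apply; rewrite /=; lia.
    have -> : (k + k + 1 == 2 ^ h + j)%N = false.
      by apply/eqP => kk; move/eqP: (anc 0%N); apply; rewrite /=; lia.
    have -> : (k == 2 ^ h + j)%N = false by lia.
    exact: good.
  - move=> s' [good' leaves' fr rm]; split=> //.
      split=> // i ih; rewrite leaves' ?leq_addr // /update /= sk eqn_add2l.
      by case: eqP => // _; apply: leaves.
    by apply: frame_trans fr; apply: frame_update.
by rewrite /=; lia.
Qed.

Lemma wp_descend key h f x s :
  rmem s keys = key -> rmem s thr 0 = x -> nmem s width 0 = (2 ^ h)%N ->
  nmem s nodes = f -> (forall k, (0 < k < 2 ^ h)%N -> max_node key f k) ->
  x <= key (f 1%N) ->
  wp descend (h * 40 + 20)%N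
    (fun s' => exists j, [/\ nmem s' cur 0 = (2 ^ h + j)%N, (j < 2 ^ h)%N,
        x <= key (f (2 ^ h + j)%N),
        forall i, (j < i < 2 ^ h)%N -> key (f (2 ^ h + i)%N) < x &
        [/\ nmem s' nodes = f, frame [:: cur] s s' & rmem s' = rmem s]]) s.
Proof.
move=> skey sx sw sf good root.
(* The current cell [k] has depth [d] and lies [r] levels above the leaves; all leaves to the right
   of its subtree are already known to be below [x]. *)
pose K r s' := exists k d, [/\ nmem s' cur 0 = k,
  (d + r == h)%N && (2 ^ d <= k < 2 ^ d.+1)%N,
  x <= key (f k),
  forall j, (k.+1 * 2 ^ r <= j < 2 ^ h + 2 ^ h)%N -> key (f j) < x &
  [/\ nmem s' nodes = f, frame [:: cur] s s' & rmem s' = rmem s]].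
eapply wp_le.
  apply: wp_seq; apply: wp_nwrite => /=.
  apply: (@wp_while _ _ _ _ K _ _ _ h).
  - move=> r s1 [k [d [s1k /andP[/eqP dr kd] xk right [s1f fr rm]]]] /=.
    rewrite s1k (fr width) // sw addn1 => km.
    case: r dr right => [|r] dr right.
      by move: kd km; rewrite -dr addn0; lia.
    exists r => //.
    have r0 : (0 < 2 ^ r)%N by rewrite expn_gt0.
    have hE : (2 ^ h = 2 ^ d * (2 * 2 ^ r))%N by rewrite -expnS -expnD dr.
    rewrite expnS in right; rewrite !expnS in kd.
    have k0 : (0 < 2 ^ d)%N by rewrite expn_gt0.
    have km' : (0 < k < 2 ^ h)%N by lia.
    have upd k' : (k' = k + k \/ k' = k + k + 1)%N -> x <= key (f k') ->
        (forall j, (k'.+1 * 2 ^ r <= j < 2 ^ h + 2 ^ h)%N -> key (f j) < x) ->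
        K r (Memory (update (nmem s1) cur 0 k') (rmem s1)).
      move=> k'k xk' right'; exists k', d.+1; split=> //=.
        by apply/andP; split; [lia|rewrite !expnS; lia].
      by split=> //; apply: frame_trans fr _; apply: frame_update.
    apply: wp_if => /=; rewrite rm skey sx s1f !s1k => xr;
      apply: wp_nwrite => /=; rewrite !s1k.
      apply: upd => //; first by right.
      by move=> j jr; apply: right; move: jr; nia.
    rewrite -ltNge in xr; apply: upd; first by left.
      by move: xk; rewrite (good k) // le_max [X in _ || X]leNgt xr orbF.
    (* Leaves under the rejected right child are bounded by its winner; those further right are
       covered by the invariant. *)
    move=> j jr; have [jk|kj] := ltnP j ((k + k + 1).+1 * 2 ^ r).
      apply: le_lt_trans xr.
      apply: (@subtree_le _ key (2 ^ h) f r) => //; first lia.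
        by move: jr; nia.
      by case/andP: jr.
    by apply: right; move: jr; nia.
  - move=> r s1 [k [d [s1k /andP[/eqP dr kd] xk right [s1f fr rm]]]] /=.
    rewrite s1k (fr width) // sw addn1 -leqNgt => km.
    have r0 : r = 0%N.
      case: r dr right => // r dr _; move: kd km.
      have : (2 ^ d.+1 <= 2 ^ h)%N by rewrite leq_exp2l //; lia.
      lia.
    have dh : d = h by lia.
    rewrite r0 expn0 muln1 in right; rewrite dh expnS in kd.
    exists (k - 2 ^ h)%N; rewrite subnKC //; split=> //; first lia.
    by move=> i ij; apply: right; lia.
  - exists 1%N, 0%N; rewrite /update /= add0n eqxx; split=> //.
      by move=> j; rewrite mul2n -addnn; lia.
    by split=> //; apply: frame_update.
by rewrite /=; lia.
Qed.

End TreePrograms.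

(** * Building trees and sorting the tasks *)

Definition build :=
  for_count (Seq (assign cur (NAdd (var width) (var idx)))
    (set_leaf (NRead order (var idx)))).

(** With the root's key as threshold, [pop] returns a task of maximal key, so the tasks come out by
    decreasing start time. *)
Definition extract :=
  for_count (Seq (RWrite thr (NConst 0) (key_at (NConst 1)))
    (Seq pop (NWrite order (var idx) (var won)))).

Definition stop_time := RRead 2 (var task).
(* Programs contain no real constants. *)
Definition real_zero := RSub stop_time stop_time.

(** If no unvisited task starts at or after the current stop time, the next arc wraps around and the
    threshold 0 admits every unvisited task. The subtractions of 1 undo the shift in the tree
    entries. *)
Definition tour :=
  for_count (Seq
    (If (BLeR stop_time (key_at (NConst 1)))
      (RWrite thr (NConst 0) stop_time)
      (RWrite thr (NConst 0) real_zero))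
    (Seq pop
      (Seq (NWrite 1 (var task) (NSub (var won) (NConst 1)))
        (assign task (NSub (var won) (NConst 1)))))).

Section TaskPrograms.
Variables (R : realType) (n : nat) (u : 'I_n).
Implicit Types (s : memory R) (q : seq 'I_n) (U : {set 'I_n}).

(* Task [i] is stored as [i.+1] in the tree, 0 standing for a vacant leaf; the
   key of 0 will be [- T], below the start time of every task. *)
Definition slot q U j : nat :=
  if (j < size q)%N && (nth u q j \in U) then (nth u q j).+1 else 0%N.

(** Any [U] containing [q] is allowed because the program serves twice: for all tasks in index
    order, then for the sorted tasks other than [u]. *)
Lemma wp_build key h q s :
  rmem s keys = key -> nmem s width 0 = (2 ^ h)%N -> nmem s count 0 = size q ->
  (size q <= 2 ^ h)%N ->
  (forall j, (j < size q)%N -> nmem s order j = (nth u q j).+1) ->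
  tournament key (2 ^ h) (nmem s nodes) (fun=> 0%N) ->
  wp build (size q * (h * 60 + 120) + 20)%N
    (fun s' => [/\ forall U, {subset q <= U} ->
        tournament key (2 ^ h) (nmem s' nodes) (slot q U),
        frame [:: nodes; cur; idx] s s' & rmem s' = rmem s]) s.
Proof.
move=> skey sw sc sz sq t0.
pose K j s' := [/\ tournament key (2 ^ h) (nmem s' nodes)
    (fun i => if (i < j)%N then (nth u q i).+1 else 0%N),
  frame [:: nodes; cur; idx] s s' & rmem s' = rmem s].
eapply wp_le.
  apply: wp_mono (@wp_for_count R (size q) _ _ K s sc _ _) (leqnn _) _.
  - by split=> //; apply: frame_update.
  - move=> j s1 jq s1j s1c [tj fr rm].
    apply: wp_seq; apply: wp_nwrite => /=.
    apply: wp_mono (@wp_set_leaf R key h _ j _ _ _ _ _ _) (leqnn _) _.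
    + by rewrite rm.
    + by rewrite /update /= fr // sw s1j.
    + by apply: leq_trans sz.
    + exact: tj.
    move=> s2 [t2 fr2 rm2]; rewrite !fr2 //; split=> //; split=> /=.
    + apply: tournament_ext t2 _ => i im /=.
      rewrite /update /= s1j fr // sq // ltnS [(i <= j)%N]leq_eqVlt.
      by case: eqP => [->|].
    + apply: frame_trans fr _.
      apply: (@frame_trans _ _ _ s2); last exact: frame_update.
      apply: (frame_sub (A := [:: nodes; cur])).
        by move=> x; rewrite !inE => /orP[] ->; rewrite ?orbT.
      by apply: frame_trans fr2; apply: frame_update.
    + by rewrite rm2.
  move=> s' [tq fr rm]; split=> // U qU; apply: tournament_ext tq _ => i im.
  by rewrite /slot; case: ifP => //= iq; rewrite qU // mem_nth.
by rewrite /=; nia.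
Qed.

(** As vacant leaves have a key below [x], the descent ends at a task of [U], and at the one placed
    last in [q] among those with key at least [x]. *)
Lemma wp_pop key h q U x s :
  rmem s keys = key -> rmem s thr 0 = x -> nmem s width 0 = (2 ^ h)%N ->
  uniq q -> (size q <= 2 ^ h)%N ->
  tournament key (2 ^ h) (nmem s nodes) (slot q U) ->
  key 0%N < x <= key (nmem s nodes 1) ->
  wp pop (h * 100 + 120)%N
    (fun s' => exists i : 'I_n, [/\ i \in U, nmem s' won 0 = i.+1,
        x <= key i.+1,
        forall w, w \in q -> w \in U -> x <= key w.+1 ->
           (index w q <= index i q)%N &
        [/\ tournament key (2 ^ h) (nmem s' nodes) (slot q (U :\ i)),
            frame [:: nodes; cur; won] s s' & rmem s' = rmem s]]) s.
Proof.
move=> skey sx sw uq sz [good leaves] /andP[x0 xroot]; eapply wp_le.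
  apply: wp_seq.
  apply: wp_mono (wp_descend skey sx sw (erefl _) good xroot) (leqnn _) _ => /=.
  move=> s1 [j [s1j jm xj right [s1f fr rm]]].
  apply: wp_seq; apply: wp_nwrite => /=; rewrite s1j s1f leaves //.
  move: xj; rewrite leaves // {1}/slot; case: ifP; last by rewrite leNgt x0.
  move=> /andP[jq jU] xj.
  have slotj : slot q U j = (nth u q j).+1 by rewrite /slot jq jU.
  apply: wp_mono (@wp_set_leaf R key h (NConst 0) j (slot q U) _ _ _ jm _)
    (leqnn _) _ => /=.
  + by rewrite rm.
  + by [].
  + by rewrite /update /= s1f; split.
  move=> s2 [t2 fr2 rm2]; exists (nth u q j); split=> //.
  - by rewrite fr2 //= slotj.
  (* A later eligible [w] would occupy a leaf to the right of the one found. *)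
  - move=> w wq wU xw; rewrite index_uniq // leqNgt; apply/negP => jw.
    have wsz : (index w q < size q)%N by rewrite index_mem.
    have := right (index w q); rewrite leaves (leq_trans wsz sz) //.
    rewrite /slot wsz nth_index // wU /= ltNge xw jw.
    by move=> /(_ isT).
  - split; last by rewrite rm2.
      apply: tournament_ext t2 _ => i im; rewrite /slot !inE.
      case: eqP => [->|/eqP ij]; first by rewrite eqxx andbF.
      by case: ltnP => //= iq; rewrite nth_uniq // ij.
    apply: (@frame_trans _ _ _ s1).
      by apply: frame_sub fr => y; rewrite !inE => ->; rewrite orbT.
    apply: (@frame_trans _ _ _ _ _ _ (frame_sub _ fr2)).
      exact: frame_update.
    by move=> y; rewrite !inE => /orP[] ->; rewrite ?orbT.
by rewrite /=; lia.
Qed.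

Definition descending (key : nat -> R) :=
  pairwise (fun x y : 'I_n => key y.+1 <= key x.+1).

Lemma descending_index key q v w : descending key q -> v \in q -> w \in q ->
  (index w q <= index v q)%N -> key v.+1 <= key w.+1.
Proof.
move=> qd vq wq; rewrite leq_eqVlt => /orP[/eqP wv|wv].
  by rewrite -(nth_index u vq) -wv nth_index.
have /(pairwiseP u) := qd => /(_ (index w q) (index v q)).
by rewrite !inE !index_mem !nth_index //; apply.
Qed.

Lemma wp_extract key h p s :
  rmem s keys = key -> nmem s width 0 = (2 ^ h)%N -> nmem s count 0 = n.-1 ->
  uniq p -> (forall i, i \in p) -> (size p <= 2 ^ h)%N ->
  tournament key (2 ^ h) (nmem s nodes) (slot p [set~ u]%SET) ->
  (forall i : 'I_n, key 0%N < key i.+1) ->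
  wp extract (n.-1 * (h * 100 + 160) + 20)%N
    (fun s' => exists q, [/\ uniq q && descending key q,
        q =i [set~ u]%SET, size q = n.-1,
        forall j, (j < size q)%N -> nmem s' order j = (nth u q j).+1 &
        [/\ tournament key (2 ^ h) (nmem s' nodes) (fun=> 0%N),
            frame [:: nodes; cur; won; order; idx] s s' &
            forall x, x != thr -> rmem s' x = rmem s x]]) s.
Proof.
move=> skey sw sc up pall sz t0 key0.
(* [q] lists the tasks extracted so far and [U] those left in the tree. Keys in [q] dominate keys in
   [U], so appending a task of [U] keeps [q] descending. *)
pose K j s' := exists q U, [/\ uniq q && descending key q,
  (forall x, (x \in q) = (x != u) && (x \notin U)) /\ u \notin U,
  (#|U| + j = n.-1)%N /\ size q = j,
  (forall x y, x \in q -> y \in U -> key y.+1 <= key x.+1) /\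
  (forall j, (j < size q)%N -> nmem s' order j = (nth u q j).+1) &
  [/\ tournament key (2 ^ h) (nmem s' nodes) (slot p U),
      frame [:: nodes; cur; won; order; idx] s s' &
      forall x, x != thr -> rmem s' x = rmem s x]].
eapply wp_le.
  apply: wp_mono (@wp_for_count R n.-1 _ _ K s sc _ _) (leqnn _) _.
  - exists [::], [set~ u]%SET; split=> //;
      last by split=> //; apply: frame_update.
      split; first by move=> x; rewrite !inE; case: eqP.
      by rewrite !inE eqxx.
    by rewrite addn0 cardsC1 card_ord.
  - move=> j s1 jn s1j s1c [q [U [/andP[uq qd] [qU uU] [cU sq] [le_qU s1q]
      [t1 fr rm]]]].
    have fr' x : x \notin [:: nodes; cur; won; order; idx] ->
        forall k, nmem s1 x k = nmem s x k by move=> ? ?; apply: fr.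
    have rm3 : rmem s1 keys = key by rewrite rm.
    (* The popped task reaches the root's key, which dominates all of [U]; hence it is maximal in
       [U]. *)
    have root w : w \in U -> key w.+1 <= key (nmem s1 nodes 1%N).
      move=> wU; have wsz : (index w p < size p)%N by rewrite index_mem.
      have := leaf_le_root t1 (leq_trans wsz sz).
      by rewrite /slot wsz nth_index // wU.
    have [w wU] : exists w, w \in U by apply/card_gt0P; lia.
    apply: wp_seq; apply: wp_rwrite => /=; apply: wp_seq; rewrite rm3.
    apply: wp_mono (@wp_pop key h p U (key (nmem s1 nodes 1)) _ _ _ _ up sz _ _)
      (leqnn _) _; rewrite //=.
    + by rewrite fr'.
    + by rewrite lexx (lt_le_trans (key0 w)) // root.
    move=> s2 [i [iU s2w rooti _ [t2 fr2 rm2]]].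
    have ui : i != u by apply: contraNneq uU => <-.
    apply: wp_nwrite => /=; rewrite /update /= (fr2 idx) // (fr2 count) //=.
    rewrite s1j s1c s2w; split=> //.
    exists (rcons q i), (U :\ i)%SET; rewrite size_rcons; split=> /=.
    + rewrite rcons_uniq uq qU ui iU /= /descending pairwise_rcons.
      apply/andP; split=> //; apply/allP => x xq; exact: le_qU.
    + split; last by rewrite !inE (negPf uU) andbF.
      move=> x; rewrite mem_rcons !inE qU.
      by case: eqP => [->|_] //=; rewrite ui.
    + by split; [move: cU; rewrite (cardsD1 i U) iU add1n addSnnS|rewrite sq].
    + split.
        move=> x y; rewrite mem_rcons !inE => /orP[/eqP ->|xq] /andP[_ yU].
          exact: le_trans (root _ yU) rooti.
        exact: le_qU.
      move=> k; rewrite ltnS nth_rcons /update /= sq; case: ltngtP => // kj _.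
      by rewrite fr2 // s1q // sq.
    split=> //=.
    + apply: frame_trans fr _; apply: (@frame_trans _ _ _ s2).
        apply: (frame_sub (A := [:: nodes; cur; won])) fr2 => y.
        by rewrite !inE => /or3P[] ->; rewrite ?orbT.
      apply: (@frame_trans _ _ _
        (Memory (update (nmem s2) order j i.+1) (rmem s2)));
        exact: frame_update.
    + by move=> x xt; rewrite rm2 /update (negPf xt) /= rm.
  move=> s' [q [U [qq [qU uU] [cU sq] [_ s'q] [t' fr rm]]]]; exists q.
  (* All slots are now vacant, which leaves the tree ready for the second build. *)
  have U0 : U = finset.set0 by apply/eqP; rewrite -cards_eq0; lia.
  split=> //; first by move=> x; rewrite qU U0 !inE andbT.
  split=> //; apply: tournament_ext t' _ => i _.
  by rewrite /slot U0 inE andbF.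
by rewrite /=; nia.
Qed.

End TaskPrograms.

(** * The nearest neighbor program *)

Section TransitionOrder.
Variables (R : realType) (I : finType) (J : instance R I).
Notation T := (period J).
Notation a := (task_start J).
Notation b := (task_stop J).

Lemma transitionE i j :
  transition J i j = a j - b i + (if a j < b i then T%:R else 0).
Proof.
have T0 := period_gt0 J.
have /andP[a0 aT] := task_start_itv J j; have /andP[b0 bT] := task_stop_itv J i.
rewrite /transition; case: ltrP => ab.
  by apply: (@modT_uniq _ _ T0 _ _ (-1)); [apply/andP; split; lra|lra].
by rewrite modT_id //; [lra|apply/andP; split; lra].
Qed.

(** In the first case [v] is reached without wrapping, while a [w] starting before [b i] costs at
    least [T - b i], which exceeds [a v - b i]. In the second case both arcs wrap and [T]
    cancels. *)
Lemma transition_le i v w :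
  (b i <= a v) && ((b i <= a w) ==> (a v <= a w)) || (a v <= a w < b i) ->
  transition J i v <= transition J i w.
Proof.
have /andP[v0 vT] := task_start_itv J v.
have /andP[w0 wT] := task_start_itv J w.
have /andP[b0 bT] := task_stop_itv J i.
rewrite !transitionE => /orP[/andP[bv]|/andP[vw wb]].
  rewrite (ltNge (a v)) bv; case: (lerP (b i) (a w)) => /= [bw vw|wb _]; lra.
by rewrite wb (le_lt_trans vw wb); lra.
Qed.

End TransitionOrder.

(** * The tour carries out the nearest neighbor procedure *)

Definition walk :=
  Seq tour (NWrite 1 (var task) (NRead 0 (NConst 1))).

Section Walk.
Variables (R : realType) (n : nat) (J : instance R 'I_n) (u : 'I_n).
Implicit Types (s : memory R) (q : seq 'I_n) (U : {set 'I_n}).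

(* The arcs already output when the current task is [c] and [U] is unvisited;
   cells of the other tasks still hold the junk value 0. *)
Definition written s (c : 'I_n) U : {set 'I_n * 'I_n} :=
  [set p | [&& p.1 \notin U, p.1 != c & nmem s 1 (val p.1) == val p.2]].

Lemma wp_walk key h q s :
  rmem s keys = key -> nmem s width 0 = (2 ^ h)%N -> nmem s count 0 = n.-1 ->
  nmem s 0 1 = u -> nmem s task 0 = u ->
  (forall i : 'I_n, rmem s 2 i = task_stop J i) ->
  (forall i : 'I_n, key i.+1 = task_start J i) -> key 0%N < 0 ->
  uniq q -> descending key q -> q =i [set~ u]%SET -> (size q <= 2 ^ h)%N ->
  tournament key (2 ^ h) (nmem s nodes) (slot u q [set~ u]%SET) ->
  wp walk (n.-1 * (h * 100 + 200) + 60)%N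
    (fun s' => nearest_neighbor J u (output n s')) s.
Proof.
move=> skey sw sc su stask sb key_a key0 uq qd qE sz t0.
(* The third clause is a continuation: every completion of the loop from the present state is an
   outcome of the whole procedure. Each round discharges one [NNStep]. *)
pose K j s' := exists (c : 'I_n) U,
  [/\ nmem s' task 0 = c /\ c \notin U,
    (#|U| + j = n.-1)%N /\ U \subset [set~ u]%SET,
    forall M, nn_loop J u c U (written s' c U) M -> nearest_neighbor J u M,
    tournament key (2 ^ h) (nmem s' nodes) (slot u q U) &
    frame [:: 1%N; nodes; cur; won; task; idx] s s' /\
    forall x, x != thr -> rmem s' x = rmem s x].
eapply wp_le.
  apply: wp_seq.
  apply: wp_mono (@wp_for_count R n.-1 _ _ K s sc _ _) (leqnn _) _.
  - exists u, [set~ u]%SET; split=> //; last by split=> //; apply: frame_update.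
    + by rewrite !inE eqxx.
    + by rewrite addn0 cardsC1 card_ord.
    + move=> M; suff -> : written _ u [set~ u]%SET = finset.set0 by [].
      by move=> s1; apply/setP => p; rewrite !inE negbK; case: eqP.
  - move=> j s1 jn s1j s1c [c [U [[s1t cU] [cardU Uu] loopU t1 [fr rm]]]].
    have rm3 : rmem s1 keys = key by rewrite rm.
    have Uq w : w \in U -> w \in q.
      by move=> wU; rewrite qE (fintype.subsetP Uu).
    have root w : w \in U -> key w.+1 <= key (nmem s1 nodes 1%N).
      move=> wU; have wsz : (index w q < size q)%N by rewrite index_mem Uq.
      have := leaf_le_root t1 (leq_trans wsz sz).
      by rewrite /slot wsz nth_index ?Uq // wU.
    have [w0 w0U] : exists w, w \in U by apply/card_gt0P; lia.
    (* Both branches of the test run the same code afterwards; they differ only in the threshold [x]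
       and the reason why it yields a nearest neighbor. *)
    have popP x : 0 <= x <= key (nmem s1 nodes 1%N) ->
        x = task_stop J c \/
          (x = 0 /\ forall w, w \in U -> key w.+1 < task_stop J c) ->
        forall r, r = update (rmem s1) thr 0 x ->
        wp (Seq pop
             (Seq (NWrite 1 (var task) (NSub (var won) (NConst 1)))
               (assign task (NSub (var won) (NConst 1)))))
          (h * 100 + 140)%N
          (fun s' => [/\ nmem s' idx 0 = j, nmem s' count 0 = n.-1
             & K j.+1 (Memory (update (nmem s') idx 0 j.+1) (rmem s'))])
          (Memory (nmem s1) r).
      move=> /andP[x0 xroot] xP r rE; eapply wp_le.
        apply: wp_seq.
        apply: wp_mono (@wp_pop R n u key h q U x _ _ _ _ uq sz _ _)
          (leqnn _) _;
          rewrite /= ?rE //.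
        - by rewrite fr.
        - by rewrite (lt_le_trans key0 x0) xroot.
        move=> s2 [i [iU s2w xi closest [t2 fr2 rm2]]].
        apply: wp_seq; apply: wp_nwrite; apply: wp_nwrite => /=.
        rewrite /update /= (fr2 idx) // (fr2 count) // (fr2 task) //=.
        rewrite s1j s1c s1t s2w subn1 /=; split=> //.
        have ci : c != i by apply: contraNneq cU => ->.
        exists i, (U :\ i)%SET; split=> //=.
        + by rewrite !inE eqxx.
        + split; first by move: cardU; rewrite (cardsD1 i U) iU add1n addSnnS.
          by apply: fintype.subset_trans Uu; apply: subD1set.
        + move=> M loopM; apply: loopU; apply: (NNStep (v := i)) => //.
            move=> w wU; apply: transition_le; rewrite -!key_a.
            case: xP => [xc|[xc late]].
              rewrite -xc xi /=; apply/orP; left; apply/implyP => xw.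
              by apply: (descending_index u qd); rewrite ?Uq // closest // Uq.
            apply/orP; right; rewrite late // andbT.
            apply: (descending_index u qd); rewrite ?Uq // closest ?Uq //.
            rewrite xc key_a; by case/andP: (task_start_itv J w).
          (* The former current task [c] now counts as written, with head [i], while [i] becomes the
             excluded current task: the arc set grows by exactly [(c, i)]. *)
          congr (nn_loop _ _ _ _ _ _): loopM; apply/setP => -[y z].
          rewrite !inE /update /= xpair_eqE.
          case: (y =P c) => [->|/eqP yc] /=.
            by rewrite (negPf cU) ci eqxx andbF orbF (inj_eq val_inj) eq_sym.
          rewrite (inj_eq val_inj) (negPf yc) fr2 // negb_and negbK.
          by case: (y =P i) => [->|] //=; rewrite iU.
        + split.
            apply: frame_trans fr _; apply: (@frame_trans _ _ _ s2).
              apply: (frame_sub (A := [:: nodes; cur; won])) fr2 => y.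
              by rewrite !inE => /or3P[] ->; rewrite ?orbT.
            move=> y k; rewrite !inE /update /= => /norP[/negPf-> /norP[_]].
            by move=> /norP[_ /norP[_]] /norP[/negPf-> /negPf->].
          by move=> y yt; rewrite rm2 /update (negPf yt) /= rm.
      by rewrite /=; lia.
    apply: wp_seq; apply: wp_if => /=; rewrite rm3 (rm 2%N) // s1t sb => bc;
      apply: wp_rwrite => /=; rewrite (rm 2%N) // s1t sb.
      apply: popP; last by []; last by left.
      by rewrite bc andbT; case/andP: (task_stop_itv J c).
    rewrite subrr; apply: popP; last by [].
      rewrite lexx; apply: le_trans (root w0 w0U); rewrite key_a.
      by case/andP: (task_start_itv J w0).
    (* The root's key bounds all unvisited start times, so the failed test puts each of them before
       the stop time of [c]. *)
    by right; split=> // w wU; apply: le_lt_trans (root w wU) _; rewrite ltNge.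
  move=> s' [c [U [[s't cU] [cardU Uu] loopU _ [fr _]]]].
  have U0 : U = finset.set0 by apply/eqP; rewrite -cards_eq0; lia.
  apply: wp_nwrite => /=; rewrite s't fr // su.
  (* With nothing unvisited, the closing arc matches the final write at cell [c]. *)
  have := @NNDone R _ J u c (written s' c U); rewrite -[X in nn_loop _ _ _ X]U0.
  move=> /loopU; congr (nearest_neighbor _ _ _); apply/setP => -[y z].
  rewrite !inE /update /= xpair_eqE U0 inE.
  case: (y =P c) => [->|/eqP yc] /=.
    by rewrite eqxx orbF (inj_eq val_inj) eq_sym.
  by rewrite (inj_eq val_inj) (negPf yc).
by rewrite /=; nia.
Qed.

End Walk.

(** * Initialization, the whole program and its running time *)

Definition widen :=
  Seq (assign width (NConst 1))
    (While (BLeN (var width) (var 0))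
      (assign width (NAdd (var width) (var width)))).

(** Cell 0 of [keys] starts at 0, so the subtraction stores [- T], the key of vacant leaves. Filling
    [order] with shifted indices makes the first build place task [i] at leaf [i]. *)
Definition load_tasks :=
  Seq (RWrite keys (NConst 0)
        (RSub (RRead keys (NConst 0)) (RRead 0 (NConst 0))))
    (Seq (assign count (var 0))
      (for_count
        (Seq (RWrite keys (NAdd (var idx) (NConst 1)) (RRead 1 (var idx)))
          (NWrite order (var idx) (NAdd (var idx) (NConst 1)))))).

Definition first_task := NRead 0 (NConst 1).

(** The first task counts as visited from the start, so its leaf is vacated before sorting; sorting
    and touring then handle the other [n - 1] tasks. *)
Definition nn_program :=
  Seq widen (Seq load_tasks (Seq build
    (Seq (assign cur (NAdd (var width) first_task)) (Seq (set_leaf (NConst 0))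
      (Seq (assign count (NSub (var 0) (NConst 1))) (Seq extract
        (Seq build (Seq (assign task first_task) walk)))))))).

(** The successor of the logarithm is the height of the trees; 1000 is a generous constant absorbing
    all costs. *)
Definition nn_time n := (1000 * (n * (trunc_log 2 n).+1))%N.

Section Program.
Variable R : realType.
Implicit Types s : memory R.

Lemma wp_widen n s : (0 < n)%N -> nmem s 0 0 = n ->
  wp widen ((trunc_log 2 n).+1 * 20 + 20)%N
    (fun s' => [/\ nmem s' width 0 = (2 ^ (trunc_log 2 n).+1)%N,
       frame [:: width] s s' & rmem s' = rmem s]) s.
Proof.
move=> n0 sn; set l := trunc_log 2 n.
pose K r s' := exists e, [/\ (e + r = l.+1)%N, nmem s' width 0 = (2 ^ e)%N,
  frame [:: width] s s' & rmem s' = rmem s].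
eapply wp_le.
  apply: wp_seq; apply: wp_nwrite => /=.
  apply: (@wp_while _ _ _ _ K _ _ _ l.+1).
  - move=> r s1 [e [er s1w fr rm]] /=; rewrite (fr 0%N) // sn s1w => en.
    have el : (e <= l)%N by apply: trunc_log_max.
    exists r.-1; first by lia.
    apply: wp_nwrite => /=; exists e.+1; split=> //; first lia.
      by rewrite /update /= s1w expnS mul2n addnn.
    by apply: frame_trans fr _; apply: frame_update.
  - move=> r s1 [e [er s1w fr rm]] /=; rewrite (fr 0%N) // sn s1w -ltnNge => ne.
    split=> //; congr (2 ^ _)%N.
    suff : (l < e)%N by lia.
    rewrite ltnNge; apply/negP => el.
    have : (2 ^ e <= n)%N.
      by apply: leq_trans (trunc_logP (isT : (1 < 2)%N) n0); rewrite leq_exp2l.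
    by rewrite leqNgt ne.
  - by exists 0%N; split=> //; apply: frame_update.
by rewrite /=; lia.
Qed.

Lemma wp_load_tasks n s :
  nmem s 0 0 = n -> rmem s keys 0 = 0 ->
  wp load_tasks (n * 60 + 50)%N
    (fun s' => [/\ nmem s' count 0 = n, frame [:: order; count; idx] s s',
       (forall x, x != keys -> rmem s' x = rmem s x),
       rmem s' keys 0 = - rmem s 0 0 &
       forall j, (j < n)%N -> rmem s' keys j.+1 = rmem s 1 j
         /\ nmem s' order j = j.+1]) s.
Proof.
move=> sn sk0.
pose K m s' := [/\ nmem s' count 0 = n, frame [:: order; count; idx] s s',
   (forall x, x != keys -> rmem s' x = rmem s x),
   rmem s' keys 0 = - rmem s 0 0 &
   forall j, (j < m)%N -> rmem s' keys j.+1 = rmem s 1 j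
     /\ nmem s' order j = j.+1].
eapply wp_le.
  apply: wp_seq; apply: wp_rwrite; apply: wp_seq; apply: wp_nwrite => /=.
  apply: (@wp_for_count R n _ _ K).
  - by rewrite /update.
  - split=> //=.
    + by apply: (@frame_trans _ _ _
        (Memory (update (nmem s) count 0 (nmem s 0 0)) (rmem s)));
        apply: frame_update.
    + by move=> x xk; rewrite /update (negPf xk).
    + by rewrite /update /= sk0 sub0r.
  move=> j s1 jn s1j s1c [_ fr rm s1k0 s1E].
  apply: wp_seq; apply: wp_rwrite; apply: wp_nwrite => /=.
  rewrite /update /= s1j; split=> //; split=> //=.
  - apply: frame_trans fr _; apply: (@frame_trans _ _ _
      (Memory (update (nmem s1) order j (j + 1)%N) (rmem s1)));
      exact: frame_update.
  - by move=> x xk; rewrite -(rm x xk) (negPf xk).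
  - by rewrite addn1.
  - move=> k; rewrite ltnS leq_eqVlt addn1 eqSS; case: eqP => [-> _|_ kj] /=.
      by rewrite rm.
    exact: s1E.
by rewrite /=; lia.
Qed.

Lemma wp_nn_program n (J : instance R 'I_n) (u : 'I_n) :
  wp nn_program (nn_time n) (fun s' => nearest_neighbor J u (output n s'))
    (input J u).
Proof.
set s := input J u; set h := (trunc_log 2 n).+1.
have n0 : (0 < n)%N := leq_ltn_trans (leq0n _) (ltn_ord u).
have nh : (n < 2 ^ h)%N by apply: trunc_log_ltn.
pose p := enum 'I_n.
have psz : size p = n by rewrite size_enum_ord.
have np (i : 'I_n) : nth u p i = i by rewrite nth_ord_enum.
eapply wp_le.
  apply: wp_seq; apply: wp_mono (@wp_widen n s n0 _) (leqnn _) _ => //.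
  move=> s1 [s1w fr1 rm1].
  apply: wp_seq; apply: wp_mono (@wp_load_tasks n s1 _ _) (leqnn _) _.
  - by rewrite fr1.
  - by rewrite rm1.
  move=> s2 [s2c fr2 rm2 s2k0 s2E].
  have s2w : nmem s2 width 0 = (2 ^ h)%N by rewrite fr2.
  pose key := rmem s2 keys.
  have key0 : key 0%N < 0.
    by rewrite /key s2k0 rm1 /= oppr_lt0 ltr0n period_gt0.
  have key_a (i : 'I_n) : key i.+1 = task_start J i.
    rewrite /key (s2E i (ltn_ord i)).1 rm1 /= (nth_map u) ?size_enum_ord //.
    by rewrite nth_ord_enum.
  have s2b (i : 'I_n) : rmem s2 2 i = task_stop J i.
    by rewrite rm2 // rm1 /= (nth_map u) ?size_enum_ord // nth_ord_enum.
  have s2nodes : nmem s2 nodes = fun=> 0%N.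
    by apply/funext => k; rewrite fr2 // fr1.
  apply: wp_seq.
  apply: wp_mono (@wp_build R n u key h p s2 _ _ _ _ _ _) (leqnn _) _;
    rewrite ?psz //.
  - exact: ltnW.
  - move=> j jn; rewrite (s2E j jn).2; congr _.+1.
    by rewrite -[j]/(val (Ordinal jn)) np.
  (* Untouched memory is already a valid tree: every node names 0, so all the keys compared are
     equal. *)
  - by rewrite s2nodes; split=> // k _; rewrite /max_node maxxx.
  move=> s3 [t3 fr3 rm3].
  have {}t3 := t3 [set: 'I_n]%SET (fun x _ => finset.in_setT x).
  have s3u : nmem s3 0 1 = u by rewrite fr3 // fr2 // fr1.
  apply: wp_seq; apply: wp_nwrite => /=; rewrite s3u fr3 // s2w.
  apply: wp_seq.
  apply: wp_mono (@wp_set_leaf R key h _ u _ _ _ _ _ _) (leqnn _) _.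
  - by rewrite /= rm3.
  - by [].
  - exact: ltn_trans nh.
  - exact: t3.
  move=> s4 [t4 fr4 rm4].
  apply: wp_seq; apply: wp_nwrite => /=.
  have s4n : nmem s4 0 0 = n by rewrite fr4 //= /update /= fr3 // fr2 // fr1.
  rewrite s4n subn1; apply: wp_seq.
  apply: wp_mono (@wp_extract R n u key h p _ _ _ _ _ _ _ _ _)
    (leqnn _) _ => /=.
  - by rewrite rm4 /= rm3.
  - by rewrite /update /= fr4 //= /update /= fr3.
  - by rewrite /update.
  - exact: enum_uniq.
  - by move=> i; rewrite mem_enum.
  - by rewrite psz ltnW.
  - apply: tournament_ext t4 _ => j jh /=; rewrite /slot !inE psz.
    case: eqP => [->|ju]; first by rewrite np eqxx andbF.
    case: ltnP => //= jn; rewrite -[j]/(val (Ordinal jn)) np.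
    by case: eqP => // uj; case: ju; rewrite -uj.
  - move=> i; apply: lt_le_trans key0 _; rewrite key_a.
    by case/andP: (task_start_itv J i).
  move=> s5 [q [/andP[uq qd] qE qsz s5q [t5 fr5 rm5]]].
  have s5w : nmem s5 width 0 = (2 ^ h)%N.
    by rewrite fr5 //= /update /= fr4 //= /update /= fr3.
  have s5c : nmem s5 count 0 = n.-1 by rewrite fr5.
  have qh : (size q <= 2 ^ h)%N by rewrite qsz; lia.
  have s5key : rmem s5 keys = key by rewrite rm5 //= rm4 /= rm3.
  apply: wp_seq.
  apply: (wp_mono (t' := (n.-1 * (h * 60 + 120) + 20)%N)
    (@wp_build R n u key h q s5 _ _ _ qh _ _)); rewrite ?qsz //.
    by move=> j jq; apply: s5q; rewrite qsz.
  move=> s6 [t6 fr6 rm6].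
  have s6u : nmem s6 0 1 = u.
    by rewrite fr6 // fr5 //= /update /= fr4 //= /update /=.
  apply: wp_seq; apply: wp_nwrite => /=; rewrite s6u.
  apply: (@wp_walk R n J u key h q) => //=.
  - by rewrite rm6.
  - by rewrite /update /= fr6.
  - by rewrite /update /= fr6.
  - by move=> i; rewrite rm6 rm5 //= rm4 /= rm3.
  - by apply: t6 => i; rewrite qE.
rewrite /= psz /nn_time -/h.
(* As [n] and [h] are positive, every lower-order cost is bounded by a multiple of [n * h]. *)
have h0 : (0 < h)%N by [].
nia.
Qed.

Lemma nn_program_correct : implements_nn R nn_program nn_time.
Proof.
move=> n J u; have [t [s' [es ts nn]]] := wp_nn_program J u.
by exists t, s'.
Qed.

Lemma linearithmic_bigO C : (0 < C)%N ->
  (fun n => (C * (n * (trunc_log 2 n).+1))%:R : R^o)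
    =O_\oo (fun n => n%:R * ln (n%:R : R) : R^o).
Proof.
move=> C0; have ln2 : 0 < ln (2 : R) by rewrite ln_gt0 // ltr1n.
(* The 2 absorbs the successor, since the truncated logarithm is at least 1 once [n >= 2]; dividing
   by [ln 2] converts base 2 to the natural logarithm. *)
apply/eqO_exP; exists ((C * 2)%:R / ln 2).
  by rewrite divr_gt0 // ltr0n muln_gt0 C0.
near=> n; have n2 : (2 <= n)%N by near: n; exact: nbhs_infty_ge.
have l0 : (0 < trunc_log 2 n)%N by exact: (@trunc_log_max 2 n 1).
have lnn : (trunc_log 2 n)%:R * ln 2 <= ln (n%:R : R).
  rewrite mulr_natl -lnXn // ler_ln ?posrE ?exprn_gt0 ?ltr0n //; last lia.
  by rewrite -natrX ler_nat trunc_logP //; lia.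
have ln_ge0n : 0 <= ln (n%:R : R) by rewrite ln_ge0 // ler1n; lia.
rewrite ger0_norm ?ler0n // ger0_norm ?mulr_ge0 ?ler0n //.
apply: (@le_trans _ _ ((C * 2)%:R * (n%:R * (trunc_log 2 n)%:R))).
  rewrite -!natrM ler_nat -mulnA leq_mul2l mulnCA leq_mul2l; lia.
rewrite -mulrA ler_wpM2l ?ler0n // mulrCA ler_wpM2l ?ler0n //.
by rewrite mulrC ler_pdivlMr.
Unshelve. all: by end_near. Qed.

End Program.

Theorem theorem3 (R : realType) :
  (forall (I : finType) (J : instance R I) (u : I),
      (exists M : {set I * I}, nearest_neighbor J u M) /\
      (forall M : {set I * I}, nearest_neighbor J u M ->
         fair_assignment M /\ workers J M <= (load J + 1)%:R)) /\
  (exists (P : cmd) (tm : nat -> nat),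
      implements_nn R P tm /\
      (fun n => (tm n)%:R : R^o) =O_\oo (fun n => n%:R * ln (n%:R : R) : R^o)).
Proof.
split=> [I J u|].
  split; first exact: nn_loop_exists.
  by move=> M; apply: nearest_neighbor_fair_workers.
exists nn_program, nn_time; split; first exact: nn_program_correct.
exact: linearithmic_bigO.
Qed.
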